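(* Let $\varphi\in\mathsf{LTL_f}(\mathcal{P})$ with $\mathcal{P}=\mathcal{P}_o\uplus\mathcal{U}$. Let $\iota^B=[\varphi]_\sim$, $\Delta^B(s)=\forall\mathcal{U}.\,\mathsf{tr}(s)$, and let $\mathcal{S}$ be the smallest subset of $\mathsf{LTL_f}(\mathcal{P})$ such that (i) $\iota^B\in\mathcal{S}$ and (ii) for every $s\in\mathcal{S}$ and every terminal labeled $(\alpha,b)$ of the MTBDD $\Delta^B(s)$, $\alpha\in\mathcal{S}$. Then $\mathcal{S}$ is finite, and $\langle\mathcal{S},\mathcal{P}_o,\iota^B,\Delta^B\rangle$ is a symbolic representation of the belief-state DFA $\mathcal{A}^B_\varphi$ of $\varphi$: for every $s\in\mathcal{S}$ and $w_o\in\mathbb{B}^{\mathcal{P}_o}$, the terminal of $\Delta^B(s)$ reached under $w_o$ is $\mathrm{fp}_{\mathrm{obs}}(s,w_o)$, so that $\Delta^B$ induces the same initial state, successors and accepting transitions as $\mathcal{A}^B_\varphi$.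
   Context: $\mathbb{B}=\{\bot,\top\}$; assignments $w:\mathcal{P}\to\mathbb{B}$ (identified with the set of true propositions); $w|_{\mathcal{P}_o}$ is restriction. $\mathsf{LTL_f}(\mathcal{P})$ formulas: $\varphi::=\mathit{tt}\mid\mathit{ff}\mid p\mid\neg\varphi\mid\varphi\odot\varphi\mid \mathsf{X}\varphi\mid\mathsf{X}^{s}\varphi\mid\mathsf{F}\varphi\mid\mathsf{G}\varphi\mid\varphi\,\mathsf{U}\,\varphi\mid\varphi\,\mathsf{R}\,\varphi$ ($\odot$ a binary Boolean connective). Propositional equivalence $\sim$: replace each maximal temporal subformula $\psi$ by a fresh Boolean variable $x_\psi$ and compare the resulting Boolean formulas semantically; $[\varphi]_\sim$ is a fixed unique representative of the $\sim$-class. Pairs in $\mathsf{LTL_f}(\mathcal{P})\times\mathbb{B}$: $(\alpha,a)\odot(\beta,b)=([\alpha\odot\beta]_\sim,a\odot b)$, $\neg(\alpha,a)=([\neg\alpha]_\sim,\neg a)$, $\bigwedge X=(\bigwedge_{(\varphi,b)\in X}\varphi,\bigwedge_{(\varphi,b)\in X}b)$. An MTBDD over $\mathcal{P}$ with terminals in $\mathsf{LTL_f}(\mathcal{P})\times\mathbb{B}$ is a reduced ordered decision diagram representing a function $\mathbb{B}^{\mathcal{P}}\to\mathsf{LTL_f}(\mathcal{P})\times\mathbb{B}$; its terminals are exactly the values attained; Boolean operations on MTBDDs are applied pointwise using the pair operations above. $\mathsf{tr}(\varphi)$ is defined inductively: $\mathsf{tr}(\mathit{ff})$ is the constant $(\mathit{ff},\bot)$;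 $\mathsf{tr}(\mathit{tt})$ the constant $(\mathit{tt},\top)$; $\mathsf{tr}(p)$ maps $w$ to $(\mathit{tt},\top)$ if $p\in w$ and to $(\mathit{ff},\bot)$ otherwise; $\mathsf{tr}(\mathsf{X}^s\alpha)=(\alpha,\bot)$; $\mathsf{tr}(\mathsf{X}\alpha)=(\alpha,\top)$ (constants); $\mathsf{tr}(\neg\alpha)=\neg\mathsf{tr}(\alpha)$; $\mathsf{tr}(\alpha\odot\beta)=\mathsf{tr}(\alpha)\odot\mathsf{tr}(\beta)$; $\mathsf{tr}(\alpha\mathsf{U}\beta)=\mathsf{tr}(\beta)\vee(\mathsf{tr}(\alpha)\wedge(\alpha\mathsf{U}\beta,\bot))$; $\mathsf{tr}(\mathsf{F}\alpha)=\mathsf{tr}(\alpha)\vee(\mathsf{F}\alpha,\bot)$; $\mathsf{tr}(\alpha\mathsf{R}\beta)=\mathsf{tr}(\beta)\wedge(\mathsf{tr}(\alpha)\vee(\alpha\mathsf{R}\beta,\top))$; $\mathsf{tr}(\mathsf{G}\alpha)=\mathsf{tr}(\alpha)\wedge(\mathsf{G}\alpha,\top)$. The universal quantification $\forall\mathcal{U}.m$ of an MTBDD $m$ is the MTBDD over $\mathcal{P}_o$ representing $w_o\mapsto\bigwedge\{m(w_o\sqcup w_u)\mid w_u\in\mathbb{B}^{\mathcal{U}}\}$. Formula progression $\mathrm{fp}(\varphi,w)$: $\mathrm{fp}(\mathit{tt},w)=(\mathit{tt},\top)$, $\mathrm{fp}(\mathit{ff},w)=(\mathit{ff},\bot)$;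 $\mathrm{fp}(p,w)=(\mathit{tt},\top)$ if $p\in w$, else $(\mathit{ff},\bot)$; $\mathrm{fp}(\neg\varphi,w)=\neg\mathrm{fp}(\varphi,w)$; $\mathrm{fp}(\varphi_1\odot\varphi_2,w)=\mathrm{fp}(\varphi_1,w)\odot\mathrm{fp}(\varphi_2,w)$; $\mathrm{fp}(\mathsf{X}\varphi,w)=(\varphi,\top)$; $\mathrm{fp}(\mathsf{X}^s\varphi,w)=(\varphi,\bot)$; $\mathrm{fp}(\mathsf{F}\varphi,w)=\mathrm{fp}(\varphi,w)\vee(\mathsf{F}\varphi,\bot)$; $\mathrm{fp}(\mathsf{G}\varphi,w)=\mathrm{fp}(\varphi,w)\wedge(\mathsf{G}\varphi,\top)$; $\mathrm{fp}(\varphi_1\mathsf{U}\varphi_2,w)=\mathrm{fp}(\varphi_2,w)\vee(\mathrm{fp}(\varphi_1,w)\wedge(\varphi_1\mathsf{U}\varphi_2,\bot))$; $\mathrm{fp}(\varphi_1\mathsf{R}\varphi_2,w)=\mathrm{fp}(\varphi_2,w)\wedge(\mathrm{fp}(\varphi_1,w)\vee(\varphi_1\mathsf{R}\varphi_2,\top))$. Observable progression: $\mathrm{fp}_{\mathrm{obs}}(\psi,w_o)=\bigwedge\{\mathrm{fp}(\psi,w)\mid w\in\mathbb{B}^{\mathcal{P}},\ w|_{\mathcal{P}_o}=w_o\}$, extended to nonempty words by iterating on the first component. Belief-state DFA $\mathcal{A}^B_\varphi=\langle\mathcal{S}',\mathbb{B}^{\mathcal{P}_o},\iota,\delta^B,\mathcal{T}^B\rangle$: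 $\mathcal{S}'=\{[\varphi]_\sim\}\cup\{[\psi']_\sim\mid(\psi',\_)=\mathrm{fp}_{\mathrm{obs}}(\varphi,\sigma_o),\ \sigma_o\in(\mathbb{B}^{\mathcal{P}_o})^+\}$, $\iota=[\varphi]_\sim$, $\delta^B(s,w_o)$ is the first component of $\mathrm{fp}_{\mathrm{obs}}(s,w_o)$, and $(s,w_o)\in\mathcal{T}^B$ (accepting transition) iff the second component of $\mathrm{fp}_{\mathrm{obs}}(s,w_o)$ is $\top$.
   Formalization: The conjunction of a set of pairs, used in universal quantification and in observable progression, is taken with its first component replaced by its representative under propositional equivalence; without this, successors need not lie in the state set of the belief-state DFA. *)

(* Defs.v *)
From HB Require Import structures.
From mathcomp Require Import all_boot all_order.
From mathcomp Require Import boolp classical_sets cardinality.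

Set Implicit Arguments.
Unset Strict Implicit.
Unset Printing Implicit Defensive.

(* A binary Boolean connective is given by its truth table. *)
Definition connective := {ffun bool * bool -> bool}.

Definition cand : connective := [ffun ab => ab.1 && ab.2].
Definition cor : connective := [ffun ab => ab.1 || ab.2].

(* [Next] is the weak next X, satisfied at the last position of a word;
   [SNext] is the strong next X^s. *)
Inductive ltl (P : Type) : Type :=
| Tt
| Ff
| Atom of P
| Neg of ltl P
| Bin of connective & ltl P & ltl P
| Next of ltl P
| SNext of ltl P
| Fin of ltl P
| Glob of ltl P
| Until of ltl P & ltl P
| Release of ltl P & ltl P.

Arguments Tt {P}.
Arguments Ff {P}.

Section LtlChoice.
Variable P : choiceType.

Fixpoint ltl_code (f : ltl P) : GenTree.tree (P + connective) :=
  match f with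
  | Tt => GenTree.Node 0 [::]
  | Ff => GenTree.Node 1 [::]
  | Atom p => GenTree.Leaf (inl p)
  | Neg a => GenTree.Node 2 [:: ltl_code a]
  | Bin c a b =>
      GenTree.Node 3 [:: GenTree.Leaf (inr c); ltl_code a; ltl_code b]
  | Next a => GenTree.Node 4 [:: ltl_code a]
  | SNext a => GenTree.Node 5 [:: ltl_code a]
  | Fin a => GenTree.Node 6 [:: ltl_code a]
  | Glob a => GenTree.Node 7 [:: ltl_code a]
  | Until a b => GenTree.Node 8 [:: ltl_code a; ltl_code b]
  | Release a b => GenTree.Node 9 [:: ltl_code a; ltl_code b]
  end.

Fixpoint ltl_decode (t : GenTree.tree (P + connective)) : option (ltl P) :=
  match t with
  | GenTree.Node 0 [::] => Some Tt
  | GenTree.Node 1 [::] => Some Ff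
  | GenTree.Leaf (inl p) => Some (Atom p)
  | GenTree.Node 2 [:: a] => omap (@Neg P) (ltl_decode a)
  | GenTree.Node 3 [:: GenTree.Leaf (inr c); a; b] =>
      obind (fun a => omap (Bin c a) (ltl_decode b)) (ltl_decode a)
  | GenTree.Node 4 [:: a] => omap (@Next P) (ltl_decode a)
  | GenTree.Node 5 [:: a] => omap (@SNext P) (ltl_decode a)
  | GenTree.Node 6 [:: a] => omap (@Fin P) (ltl_decode a)
  | GenTree.Node 7 [:: a] => omap (@Glob P) (ltl_decode a)
  | GenTree.Node 8 [:: a; b] =>
      obind (fun a => omap (Until a) (ltl_decode b)) (ltl_decode a)
  | GenTree.Node 9 [:: a; b] =>
      obind (fun a => omap (Release a) (ltl_decode b)) (ltl_decode a)
  | _ => None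
  end.

Lemma ltl_codeK : pcancel ltl_code ltl_decode.
Proof.
by elim=> //= [a ->|c a -> b ->|a ->|a ->|a ->|a ->|a -> b ->|a -> b ->].
Qed.

HB.instance Definition _ := Choice.copy (ltl P) (pcan_type ltl_codeK).

End LtlChoice.

(* Value of the Boolean formula obtained from [f] by replacing each maximal
   temporal subformula [psi] by the variable x_psi; [u] gives the values of
   the propositions and [x psi] that of x_psi. *)
Fixpoint bool_value (P : Type) (u : P -> bool) (x : ltl P -> bool)
    (f : ltl P) : bool :=
  match f with
  | Tt => true
  | Ff => false
  | Atom p => u p
  | Neg a => ~~ bool_value u x a
  | Bin c a b => c (bool_value u x a, bool_value u x b)
  | Next _ | SNext _ | Fin _ | Glob _ | Until _ _ | Release _ _ => x f
  end.

Definition prop_equiv (P : Type) (f g : ltl P) : Prop :=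
  forall u x, bool_value u x f = bool_value u x g.

(* [rep] sends every formula to a fixed representative of its class. *)
Definition class_representative (P : Type) (rep : ltl P -> ltl P) : Prop :=
  (forall f, prop_equiv (rep f) f) /\
  (forall f g, prop_equiv f g -> rep f = rep g).

Lemma class_representative_exists (P : choiceType) :
  exists rep : ltl P -> ltl P, class_representative rep.
Proof.
exists (fun f => choose (fun g => `[< prop_equiv g f >]) f); split=> [f|f g fg].
  by apply/asboolP/(@chooseP _ (fun g => `[< prop_equiv g f >])); apply/asboolP.
have E : (fun h => `[< prop_equiv h f >]) =1 (fun h => `[< prop_equiv h g >]).
  move=> h; apply: asbool_equiv_eq; split=> H u x; first by rewrite H fg.
  by rewrite H -fg.
by rewrite (eq_choose E); apply: choose_id; apply/asboolP.
Qed.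

Section Pairs.
Variables (P : Type) (rep : ltl P -> ltl P).

Definition pair_bin (c : connective) (x y : ltl P * bool) : ltl P * bool :=
  (rep (Bin c x.1 y.1), c (x.2, y.2)).

Definition pair_neg (x : ltl P * bool) : ltl P * bool :=
  (rep (Neg x.1), ~~ x.2).

(* Conjunction of a finite set of pairs, listed by [X].  As for the binary
   operations the first component is a class representative, so that it
   depends neither on the order nor on the multiplicities in [X]. *)
Definition pair_bigand (X : seq (ltl P * bool)) : ltl P * bool :=
  (rep (\big[Bin cand/Tt]_(x <- X) x.1), \big[andb/true]_(x <- X) x.2).

End Pairs.

(* An assignment is the set of its true propositions; an assignment of
   [V : {set P}] is a subset of [V].  The order of [P] is the variable order. *)

Inductive diagram (P T : Type) : Type :=
| DLeaf of T
| DNode of P & diagram P T & diagram P T.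

Section DiagramChoice.
Variables P T : choiceType.

Fixpoint diagram_code (d : diagram P T) : GenTree.tree (P + T) :=
  match d with
  | DLeaf t => GenTree.Leaf (inr t)
  | DNode p l h =>
      GenTree.Node 0 [:: GenTree.Leaf (inl p); diagram_code l; diagram_code h]
  end.

Fixpoint diagram_decode (t : GenTree.tree (P + T)) : option (diagram P T) :=
  match t with
  | GenTree.Leaf (inr t) => Some (DLeaf P t)
  | GenTree.Node 0 [:: GenTree.Leaf (inl p); l; h] =>
      obind (fun l => omap (DNode p l) (diagram_decode h)) (diagram_decode l)
  | _ => None
  end.

Lemma diagram_codeK : pcancel diagram_code diagram_decode.
Proof. by elim=> //= p l -> h ->. Qed.

HB.instance Definition _ := Choice.copy (diagram P T) (pcan_type diagram_codeK).

End DiagramChoice.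

Fixpoint diagram_vars (P T : Type) (d : diagram P T) : seq P :=
  if d is DNode p l h then p :: diagram_vars l ++ diagram_vars h else [::].

Fixpoint diagram_leaves (P T : Type) (d : diagram P T) : seq T :=
  match d with
  | DLeaf t => [:: t]
  | DNode _ l h => diagram_leaves l ++ diagram_leaves h
  end.

(* The first child of a node is its false branch. *)
Fixpoint diagram_eval (P : finType) (T : Type) (d : diagram P T)
    (w : {set P}) : T :=
  match d with
  | DLeaf t => t
  | DNode p l h => if p \in w then diagram_eval h w else diagram_eval l w
  end.

Section Mtbdd.
Variables (disp : Order.disp_t) (P : finOrderType disp) (T : choiceType).
Implicit Types (V : {set P}) (f : {set P} -> T).

(* Variables in [V], increasing along every branch, and no node with two equal
   children.  Diagrams are trees, which stand for the graphs obtained by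
   sharing all equal subdiagrams. *)
Fixpoint reduced_ordered V (d : diagram P T) : bool :=
  if d is DNode p l h then
    [&& p \in V, all (fun q => p < q)%O (diagram_vars l ++ diagram_vars h),
        l != h, reduced_ordered V l & reduced_ordered V h]
  else true.

Record mtbdd V := Mtbdd {
  mtbdd_diagram :> diagram P T;
  mtbdd_reduced_ordered : reduced_ordered V mtbdd_diagram }.

(* Shannon expansion of [f] along [s], the propositions in [w] being true. *)
Fixpoint shannon (s : seq P) f (w : {set P}) : diagram P T :=
  if s is p :: s' then
    let l := shannon s' f w in
    let h := shannon s' f (p |: w) in
    if l == h then l else DNode p l h
  else DLeaf P (f w).

Lemma shannon_vars s f w : {subset diagram_vars (shannon s f w) <= s}.
Proof.
elim: s w => //= p s IH w q; case: ifP => _.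
  by move=> /IH qs; rewrite inE qs orbT.
rewrite /= !inE mem_cat => /or3P[->//|/IH->|/IH->]; exact: orbT.
Qed.

Lemma shannon_reduced_ordered V s f w :
  sorted <%O s -> {subset s <= V} -> reduced_ordered V (shannon s f w).
Proof.
elim: s w => //= p s IH w ps sV.
have sV' : {subset s <= V} by move=> q qs; apply: sV; rewrite inE qs orbT.
have ss := path_sorted ps; case: ifPn => [_|lh]; first exact: IH.
rewrite /= sV ?mem_head // lh !IH //= !andbT; apply/allP => q.
rewrite mem_cat => qv; have qs : q \in s by case/orP: qv => /shannon_vars.
by move: ps; rewrite (path_sortedE Order.POrderTheory.lt_trans) => /andP[/allP] /(_ q qs).
Qed.

Lemma mtbdd_of_subproof V f :
  reduced_ordered V (shannon (sort <=%O (enum V)) f finset.set0).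
Proof.
apply: shannon_reduced_ordered => [|p]; last by rewrite mem_sort mem_enum.
by rewrite Order.TotalTheory.sort_lt_sorted enum_uniq.
Qed.

(* The MTBDD over [V] that represents the restriction of [f] to the
   assignments of [V]. *)
Definition mtbdd_of V f : mtbdd V := Mtbdd (mtbdd_of_subproof V f).

Definition mtbdd_eval V (m : mtbdd V) (w : {set P}) : T := diagram_eval m w.

Definition mtbdd_terminals V (m : mtbdd V) : seq T := diagram_leaves m.

Definition mtbdd_map V (g : T -> T) (m : mtbdd V) : mtbdd V :=
  mtbdd_of V (fun w => g (mtbdd_eval m w)).

Definition mtbdd_map2 V (g : T -> T -> T) (m n : mtbdd V) : mtbdd V :=
  mtbdd_of V (fun w => g (mtbdd_eval m w) (mtbdd_eval n w)).

End Mtbdd.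

Section Translation.
Variables (disp : Order.disp_t) (P : finOrderType disp).
Variable rep : ltl P -> ltl P.

Local Notation full := [set: P]%SET.
Local Notation mt_cst x := (mtbdd_of full (fun=> x)).
Local Notation mt_and := (mtbdd_map2 (pair_bin rep cand)).
Local Notation mt_or := (mtbdd_map2 (pair_bin rep cor)).

Fixpoint tr (f : ltl P) : mtbdd (ltl P * bool)%type full :=
  match f with
  | Tt => mt_cst (Tt, true)
  | Ff => mt_cst (Ff, false)
  | Atom p =>
      mtbdd_of full (fun w => if p \in w then (Tt, true) else (Ff, false))
  | Neg a => mtbdd_map (pair_neg rep) (tr a)
  | Bin c a b => mtbdd_map2 (pair_bin rep c) (tr a) (tr b)
  | Next a => mt_cst (a, true)
  | SNext a => mt_cst (a, false)
  | Fin a => mt_or (tr a) (mt_cst (Fin a, false))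
  | Glob a => mt_and (tr a) (mt_cst (Glob a, true))
  | Until a b => mt_or (tr b) (mt_and (tr a) (mt_cst (Until a b, false)))
  | Release a b => mt_and (tr b) (mt_or (tr a) (mt_cst (Release a b, true)))
  end.

Definition mtbdd_forall (Po U : {set P}) (m : mtbdd (ltl P * bool)%type full) :
    mtbdd (ltl P * bool)%type Po :=
  mtbdd_of Po (fun wo =>
    pair_bigand rep [seq mtbdd_eval m (wo :|: wu) | wu in powerset U]).

End Translation.

Section Progression.
Variables (P : finType) (rep : ltl P -> ltl P).

Fixpoint fp (f : ltl P) (w : {set P}) : ltl P * bool :=
  match f with
  | Tt => (Tt, true)
  | Ff => (Ff, false)
  | Atom p => if p \in w then (Tt, true) else (Ff, false)
  | Neg a => pair_neg rep (fp a w)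
  | Bin c a b => pair_bin rep c (fp a w) (fp b w)
  | Next a => (a, true)
  | SNext a => (a, false)
  | Fin a => pair_bin rep cor (fp a w) (Fin a, false)
  | Glob a => pair_bin rep cand (fp a w) (Glob a, true)
  | Until a b =>
      pair_bin rep cor (fp b w) (pair_bin rep cand (fp a w) (Until a b, false))
  | Release a b =>
      pair_bin rep cand (fp b w) (pair_bin rep cor (fp a w) (Release a b, true))
  end.

Definition fp_obs (Po : {set P}) (f : ltl P) (wo : {set P}) : ltl P * bool :=
  pair_bigand rep [seq fp f w | w in [pred w : {set P} | w :&: Po == wo]].

(* Progression through the nonempty word [wo :: sigma]. *)
Fixpoint fp_obs_word (Po : {set P}) (f : ltl P) (wo : {set P})
    (sigma : seq {set P}) : ltl P * bool :=
  if sigma is wo' :: sigma' then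
    fp_obs_word Po (fp_obs Po f wo).1 wo' sigma'
  else fp_obs Po f wo.

End Progression.

(* Acceptance is on transitions; only those from [tdfa_states] under a letter
   of [tdfa_alphabet] are meaningful. *)
Record tdfa (Q A : Type) := Tdfa {
  tdfa_states : set Q;
  tdfa_alphabet : set A;
  tdfa_init : Q;
  tdfa_trans : Q -> A -> Q;
  tdfa_acc : set (Q * A) }.

Record symbolic_dfa (disp : Order.disp_t) (P : finOrderType disp)
    (Q : choiceType) := SymbolicDfa {
  sym_states : set Q;
  sym_vars : {set P};
  sym_init : Q;
  sym_trans : Q -> mtbdd (Q * bool)%type sym_vars }.

Local Open Scope classical_set_scope.

Definition represents (disp : Order.disp_t) (P : finOrderType disp)
    (Q : choiceType) (M : symbolic_dfa P Q) (A : tdfa Q {set P}) : Prop :=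
  [/\ sym_states M = tdfa_states A,
      [set w : {set P} | w \subset sym_vars M] = tdfa_alphabet A,
      sym_init M = tdfa_init A
    & forall (s : Q) (w : {set P}), sym_states M s -> w \subset sym_vars M ->
        (mtbdd_eval (sym_trans M s) w).1 = tdfa_trans A s w /\
        ((mtbdd_eval (sym_trans M s) w).2 = true <-> tdfa_acc A (s, w))].

Definition belief_dfa (P : finType) (rep : ltl P -> ltl P) (Po : {set P})
    (phi : ltl P) : tdfa (ltl P) {set P} :=
  {| tdfa_states := [set rep phi] `|`
       [set rep (fp_obs_word rep Po phi wo sigma).1 | wo in
          [set wo : {set P} | wo \subset Po] & sigma in
          [set sigma : seq {set P} | all (fun w : {set P} => w \subset Po) sigma]];
     tdfa_alphabet := [set wo : {set P} | wo \subset Po];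
     tdfa_init := rep phi;
     tdfa_trans := fun s wo => (fp_obs rep Po s wo).1;
     tdfa_acc := [set x | (fp_obs rep Po x.1 x.2).2 = true] |}.

Section BeliefSymbolic.
Variables (disp : Order.disp_t) (P : finOrderType disp).
Variables (rep : ltl P -> ltl P) (Po U : {set P}) (phi : ltl P).

Definition belief_delta (s : ltl P) : mtbdd (ltl P * bool)%type Po :=
  mtbdd_forall rep Po U (tr rep s).

Definition terminal_closed (X : set (ltl P)) : Prop :=
  forall s, X s -> forall alpha b,
    (alpha, b) \in mtbdd_terminals (belief_delta s) -> X alpha.

Definition belief_states : set (ltl P) := smallest terminal_closed [set rep phi].

Definition belief_symbolic : symbolic_dfa P (ltl P) :=
  SymbolicDfa belief_states (rep phi) belief_delta.

End BeliefSymbolic.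

(* Main.v *)
(* An assignment of all propositions is the union of its traces on [Po] and
   [U], so universal quantification of tr(s) computes observable progression,
   and the terminals of Delta^B(s) are the observable progressions of s.  As
   progression is compatible with propositional equivalence, starting from
   [rep phi] or from [phi] gives the same states.  The states are finitely many
   because each is, up to equivalence, a Boolean function of the propositions
   and of the variables x_psi for psi a subformula of [phi]. *)

Require Import Defs.
From mathcomp Require Import all_boot all_order.
From mathcomp Require Import boolp classical_sets cardinality.

Set Implicit Arguments.
Unset Strict Implicit.
Unset Printing Implicit Defensive.

(** * Evaluation and terminals of Shannon expansions *)

Section Diagrams.
Variables (disp : Order.disp_t) (P : finOrderType disp) (T : choiceType).
Implicit Types (f : {set P} -> T) (V w : {set P}).

Lemma shannon_eval (s : seq P) f w v :
  diagram_eval (shannon s f w) v = f (w :|: [set p in s | p \in v])%SET.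
Proof.
elim: s w => [|p s IH] w /=.
  by congr f; apply/setP => q; rewrite !inE orbF.
(* A test dropped because its children coincide can be put back without changing the value. *)
transitivity (diagram_eval
    (if p \in v then shannon s f (p |: w) else shannon s f w) v).
  by case: eqP => [->|_] /=; case: ifP.
case: ifP => pv; rewrite IH; congr f; apply/setP => q; rewrite !inE.
  by case: eqP => [->|]; rewrite ?pv ?orbT.
by case: (eqVneq q p) => [->|]; rewrite ?pv ?andbF.
Qed.

(** The path to a leaf fixes the propositions it tests; those whose test was merged away may be
    taken false. *)
Lemma shannon_leaves (s : seq P) f w t :
  t \in diagram_leaves (shannon s f w) ->
  exists2 v : {set P}, {subset v <= s} & t = f (w :|: v)%SET.
Proof.
elim: s w => [|p s IH] w /=.
  rewrite inE => /eqP ->; exists finset.set0 => [q|]; first by rewrite inE.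
  by rewrite finset.setU0.
have low : t \in diagram_leaves (shannon s f w) ->
    exists2 v : {set P}, {subset v <= p :: s} & t = f (w :|: v)%SET.
  by case/IH => v vs ->; exists v => // q /vs qs; rewrite inE qs orbT.
case: ifP => _ //=; rewrite mem_cat => /orP[//|/IH[v vs ->]].
exists (p |: v)%SET => [q|]; last by rewrite finset.setUCA finset.setUA.
by rewrite !inE => /orP[->//|/vs ->]; rewrite orbT.
Qed.

Lemma mtbdd_of_eval V f w : w \subset V -> mtbdd_eval (mtbdd_of V f) w = f w.
Proof.
move=> /fintype.subsetP wV; rewrite /mtbdd_eval shannon_eval; congr f.
apply/setP => q; rewrite !inE mem_sort mem_enum.
by case: (boolP (q \in w)) => [/wV ->|]; rewrite ?andbF.
Qed.

Lemma mtbdd_of_terminals V f t :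
  t \in mtbdd_terminals (mtbdd_of V f) <->
  exists2 v : {set P}, v \subset V & t = f v.
Proof.
split=> [/shannon_leaves[v vs ->]|[v vV ->]].
  exists v; last by rewrite finset.set0U.
  by apply/fintype.subsetP => q /vs; rewrite mem_sort mem_enum.
rewrite -(mtbdd_of_eval f vV) /mtbdd_eval /mtbdd_terminals.
(* Evaluation of any diagram ends in one of its leaves. *)
elim: (mtbdd_diagram _) => [x|p l IHl h IHh] /=; first by rewrite inE.
by rewrite mem_cat; case: ifP => _; rewrite ?IHl ?IHh ?orbT.
Qed.

End Diagrams.

Fixpoint subformulas (P : choiceType) (f : ltl P) : seq (ltl P) :=
  f :: match f with
       | Tt | Ff | Atom _ => [::]
       | Neg a | Next a | SNext a | Fin a | Glob a => subformulas a
       | Bin _ a b | Until a b | Release a b => subformulas a ++ subformulas b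
       end.

Lemma subformulas_trans (P : choiceType) (f g : ltl P) :
  g \in subformulas f -> {subset subformulas g <= subformulas f}.
Proof.
elim: f => [||p|a IH|c a IHa b IHb|a IH|a IH|a IH|a IH|a IHa b IHb|a IHa b IHb];
  rewrite /= in_cons => /predU1P[-> //|]; rewrite ?in_nil // ?mem_cat;
  by [move=> /IH s h /s hs; rewrite inE hs orbT
     |case/orP => [/IHa|/IHb] s h /s hs; rewrite inE mem_cat hs ?orbT].
Qed.

(* Every [g] is here regarded as a Boolean function of the variables x_psi; the
   condition is invariant under [prop_equiv], whereas the temporal subformulas
   occurring in a class representative are arbitrary. *)
Definition determined_by (P : choiceType) (L : seq (ltl P)) (g : ltl P) : Prop :=
  forall u x y, {in L, x =1 y} -> bool_value u x g = bool_value u y g.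

(** * Progression up to propositional equivalence *)

Section Progression.
Variables (disp : Order.disp_t) (P : finOrderType disp).
Variables (rep : ltl P -> ltl P) (rep_class : class_representative rep).
Implicit Types (f g : ltl P) (w wo : {set P}) (L : seq (ltl P)).

Lemma bool_value_rep u x f : bool_value u x (rep f) = bool_value u x f.
Proof. exact: rep_class.1. Qed.

Lemma rep_id f : rep (rep f) = rep f.
Proof. exact/rep_class.2/rep_class.1. Qed.

Lemma bool_value_bigand u x (X : seq (ltl P * bool)) :
  bool_value u x (pair_bigand rep X).1 = all (fun y => bool_value u x y.1) X.
Proof.
rewrite bool_value_rep; elim: X => [|y X IH]; first by rewrite big_nil.
by rewrite big_cons /= ffunE IH.
Qed.

Lemma pair_bigand_snd (X : seq (ltl P * bool)) :
  (pair_bigand rep X).2 = all snd X.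
Proof. by rewrite /= big_all. Qed.

(** Since representatives are unique, conjunctions over differently listed families need only agree
    semantically. *)
Lemma eq_pair_bigand (X Y : seq (ltl P * bool)) :
  (forall u x, all (fun y => bool_value u x y.1) X =
               all (fun y => bool_value u x y.1) Y) ->
  all snd X = all snd Y -> pair_bigand rep X = pair_bigand rep Y.
Proof.
move=> XY1 XY2; apply: injective_projections; last by rewrite !pair_bigand_snd.
rewrite -[LHS]rep_id -[RHS]rep_id; apply: rep_class.2 => u x.
by rewrite !bool_value_bigand.
Qed.

(* Progression acts on the Boolean skeleton of a formula as a substitution,
   which makes it compatible with propositional equivalence. *)
Lemma bool_value_fp u x f w :
  bool_value u x (fp rep f w).1 =
  bool_value (fun p => p \in w) (fun g => bool_value u x (fp rep g w).1) f.
Proof.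
elim: f => //= [p|a IH|c a IHa b IHb]; first by case: ifP.
  by rewrite bool_value_rep /= IH.
by rewrite bool_value_rep /= IHa IHb.
Qed.

Lemma fp_snd f w :
  (fp rep f w).2 = bool_value (fun p => p \in w) (fun g => (fp rep g w).2) f.
Proof.
by elim: f => //= [p|a ->|c a -> b ->] //; case: ifP.
Qed.

Lemma fp_obs_equiv Po f g wo :
  prop_equiv f g -> fp_obs rep Po f wo = fp_obs rep Po g wo.
Proof.
move=> fg; apply: eq_pair_bigand => [u x|]; rewrite !all_map; apply: eq_all => w /=.
  by rewrite !bool_value_fp.
by rewrite !fp_snd.
Qed.

Lemma fp_obs_rep Po f wo : fp_obs rep Po (rep f) wo = fp_obs rep Po f wo.
Proof. exact/fp_obs_equiv/rep_class.1. Qed.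

(** Words are consumed from the front, whereas a reachable state is extended by a last letter. *)
Lemma fp_obs_word_rcons Po f wo sigma wo' :
  fp_obs_word rep Po f wo (rcons sigma wo') =
  fp_obs rep Po (fp_obs_word rep Po f wo sigma).1 wo'.
Proof. by elim: sigma f wo => //= v sigma IH f wo; rewrite IH. Qed.

Lemma tr_eval f w : mtbdd_eval (tr rep f) w = fp rep f w.
Proof.
by elim: f => [||p|a IH|c a IHa b IHb|a IH|a IH|a IH|a IH|a IHa b IHb
  |a IHa b IHb] /=; rewrite ?mtbdd_of_eval ?finset.subsetT ?IH ?IHa ?IHb.
Qed.

(** * Finiteness of the formulas determined by given temporal variables *)

Lemma determined_by_equiv L f g :
  prop_equiv f g -> determined_by L f -> determined_by L g.
Proof. by move=> fg Lf u x y xy; rewrite -!fg; apply: Lf. Qed.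

Lemma determined_by_rep L f : determined_by L f -> determined_by L (rep f).
Proof. by apply: determined_by_equiv => u x; rewrite bool_value_rep. Qed.

Lemma determined_by_bin L c f g :
  determined_by L f -> determined_by L g -> determined_by L (rep (Bin c f g)).
Proof.
move=> Lf Lg; apply: determined_by_rep => u x y xy /=.
by rewrite (Lf u x y xy) (Lg u x y xy).
Qed.

Lemma determined_by_subformulas L f :
  {subset subformulas f <= L} -> determined_by L f.
Proof.
elim: f => [||p|a IH|c a IHa b IHb|a _|a _|a _|a _|a _ b _|a _ b _] sL u x y xy //=;
  try by apply/xy/sL/mem_head.
  by rewrite (IH _ u x y xy) // => h hs; apply: sL; rewrite inE hs orbT.
by rewrite (IHa _ u x y xy) ?(IHb _ u x y xy) // => h hs; apply: sL;
  rewrite inE mem_cat hs ?orbT.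
Qed.

(** Progression only releases the argument of a next operator or reinserts a subformula headed by F,
    G, U or R. *)
Lemma determined_by_fp_subformulas L f w :
  {subset subformulas f <= L} -> determined_by L (fp rep f w).1.
Proof.
elim: f => [||p|a IH|c a IHa b IHb|a _|a _|a IH|a IH|a IHa b IHb|a IHa b IHb] sL;
  have dL := determined_by_subformulas sL.
all: try have sa : {subset subformulas a <= L}
  by move=> h hs; apply: sL; rewrite /= inE ?mem_cat hs ?orbT.
all: try have sb : {subset subformulas b <= L}
  by move=> h hs; apply: sL; rewrite /= inE ?mem_cat hs ?orbT.
all: rewrite /=; try by [|apply: determined_by_subformulas].
- by case: ifP.
- by apply: determined_by_rep => u x y xy /=; rewrite (IH sa u x y xy).
- by apply: determined_by_bin; [apply: IHa|apply: IHb].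
- by apply: determined_by_bin => //; apply: IH.
- by apply: determined_by_bin => //; apply: IH.
- apply: determined_by_bin; first exact: IHb.
  by apply: determined_by_bin => //; apply: IHa.
- apply: determined_by_bin; first exact: IHb.
  by apply: determined_by_bin => //; apply: IHa.
Qed.

(** A representative [f] may contain foreign temporal subformulas; by substitution, only the
    progressions of subformulas of [phi] affect the value. *)
Lemma determined_by_fp phi f w :
  determined_by (subformulas phi) f ->
  determined_by (subformulas phi) (fp rep f w).1.
Proof.
move=> Lf u x y xy; rewrite !bool_value_fp; apply: Lf => g gL.
by apply: determined_by_fp_subformulas xy; apply: subformulas_trans.
Qed.

Lemma determined_by_fp_obs phi Po f wo :
  determined_by (subformulas phi) f ->
  determined_by (subformulas phi) (fp_obs rep Po f wo).1.
Proof.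
move=> Lf u x y xy; rewrite !bool_value_bigand !all_map; apply: eq_all => w /=.
exact: determined_by_fp xy.
Qed.

(** A representative is recovered from its truth table, and there are finitely many tables. *)
Lemma finite_determined_by L :
  finite_set [set f | determined_by L f /\ rep f = f]%classic.
Proof.
(* Variables outside [L] read the default false, which is harmless for formulas determined by
   [L]. *)
pose table f : {ffun {set P} * (size L).-tuple bool -> bool} :=
  [ffun ux : {set P} * (size L).-tuple bool =>
    bool_value (fun p => p \in ux.1) (fun g => nth false ux.2 (index g L)) f].
have tableE f u x : determined_by L f ->
    bool_value u x f = table f ([set p | u p]%SET, map_tuple x (in_tuple L)).
  move=> Lf; rewrite ffunE /=.
  have -> : (fun p => p \in [set p | u p]%SET) = u by apply/funext => p; rewrite inE.
  by apply: Lf => g gL; rewrite (nth_map g) ?nth_index // index_mem.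
have table_inj :
    {in [set f | determined_by L f /\ rep f = f]%classic &, injective table}.
  move=> f g /set_mem[Lf <-] /set_mem[Lg <-]; rewrite /= => tfg.
  apply: rep_class.2 => u x; rewrite -bool_value_rep -[RHS]bool_value_rep.
  by rewrite !tableE ?tfg //; apply: determined_by_rep.
by rewrite -(eq_finite_set (inj_card_eq table_inj)); apply: finite_finset.
Qed.

(** * The symbolic automaton and its reachable states *)

Section BeliefStates.
Variables (Po U : {set P}) (Po_cover : (Po :|: U)%SET = [set: P]%SET).
Variables (Po_disjoint : [disjoint Po & U]) (phi : ltl P).

Lemma tr_forallE f wo :
  wo \subset Po ->
  pair_bigand rep [seq mtbdd_eval (tr rep f) (wo :|: wu)%SET | wu in powerset U] =
  fp_obs rep Po f wo.
Proof.
move=> woPo.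
(* A general predicate [a] serves both components; [w] corresponds to its trace [w :&: U]. *)
have E (a : pred (ltl P * bool)) :
    all a [seq mtbdd_eval (tr rep f) (wo :|: wu)%SET | wu in powerset U] =
    all a [seq fp rep f w | w in [pred w : {set P} | (w :&: Po)%SET == wo]].
  rewrite !all_map; apply/allP/allP => /= H w; rewrite mem_enum inE.
    move=> /eqP wwo; have := H (w :&: U)%SET.
    rewrite tr_eval -wwo -finset.setIUr Po_cover finset.setIT; apply.
    by rewrite mem_enum powersetE finset.subsetIr.
  move=> wU; rewrite tr_eval; apply: H; rewrite mem_enum inE finset.setIUl.
  rewrite (finset.setIidPl woPo) (_ : (w :&: Po)%SET = finset.set0).
    by rewrite finset.setU0.
  apply/eqP; rewrite setI_eq0 disjoint_sym.
  exact: disjointWr wU Po_disjoint.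
by apply: eq_pair_bigand.
Qed.

Lemma belief_delta_eval f wo : wo \subset Po ->
  mtbdd_eval (belief_delta rep Po U f) wo = fp_obs rep Po f wo.
Proof. by move=> woPo; rewrite mtbdd_of_eval // tr_forallE. Qed.

Lemma belief_delta_terminals f t :
  t \in mtbdd_terminals (belief_delta rep Po U f) <->
  exists2 wo : {set P}, wo \subset Po & t = fp_obs rep Po f wo.
Proof.
by rewrite mtbdd_of_terminals; split=> -[wo woPo ->]; exists wo; rewrite // tr_forallE.
Qed.

Lemma belief_states_init : belief_states rep Po U phi (rep phi).
Proof. exact: sub_gen_smallest. Qed.

Lemma belief_states_next f wo : wo \subset Po ->
  belief_states rep Po U phi (rep f) ->
  belief_states rep Po U phi (fp_obs rep Po f wo).1.
Proof.
move=> woPo Sf X [closed iX]; apply: (closed (rep f) _ _ (fp_obs rep Po f wo).2).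
  exact: Sf.
by apply/belief_delta_terminals; exists wo; rewrite // fp_obs_rep -surjective_pairing.
Qed.

Lemma belief_states_ind (X : set (ltl P)) : X (rep phi) ->
  (forall f wo, X f -> wo \subset Po -> X (fp_obs rep Po f wo).1) ->
  (belief_states rep Po U phi `<=` X)%classic.
Proof.
move=> X0 Xnext; apply: smallest_sub => [f Xf a b|_ -> //].
by move=> /belief_delta_terminals[wo woPo /(congr1 fst) /= ->]; apply: Xnext.
Qed.

(** Being a representative determined by the subformulas of [phi] is preserved by observable
    progression. *)
Lemma belief_states_finite : finite_set (belief_states rep Po U phi).
Proof.
apply: sub_finite_set (finite_determined_by (subformulas phi)).
apply: belief_states_ind => [|f wo [Lf _] _] /=.
  split; last exact: rep_id.
  exact/determined_by_rep/determined_by_subformulas.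
by split; [apply: determined_by_fp_obs | rewrite rep_id].
Qed.

Lemma belief_states_words :
  belief_states rep Po U phi = tdfa_states (belief_dfa rep Po phi).
Proof.
apply/seteqP; split.
  apply: belief_states_ind => [|f wo' + wo'Po]; first by left.
  move=> [->|[wo woPo [sigma sPo <-]]]; right.
    (* From the initial state the new word has one letter; otherwise the letter is appended to the
       word already read. *)
    by rewrite fp_obs_rep; exists wo' => //; exists [::] => //; apply: rep_id.
  exists wo => //; exists (rcons sigma wo'); first by rewrite /= all_rcons wo'Po.
  by rewrite fp_obs_word_rcons fp_obs_rep rep_id.
move=> _ [->|[wo woPo [sigma sPo <-]]]; first exact: belief_states_init.
elim/last_ind: sigma sPo => [_|sigma wo' IH] /=.
  by rewrite rep_id; apply: belief_states_next belief_states_init.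
rewrite all_rcons => /andP[wo'Po /IH Ssigma].
by rewrite fp_obs_word_rcons rep_id; apply: belief_states_next.
Qed.

End BeliefStates.

End Progression.

Theorem theorem3 (disp : Order.disp_t) (P : finOrderType disp)
    (rep : ltl P -> ltl P) (rep_class : class_representative rep)
    (Po U : {set P}) (Po_cover : Po :|: U = [set: P]%SET)
    (Po_disjoint : [disjoint Po & U]) (phi : ltl P) :
  finite_set (belief_states rep Po U phi) /\
  represents (belief_symbolic rep Po U phi) (belief_dfa rep Po phi) /\
  (forall (s : ltl P) (wo : {set P}),
     belief_states rep Po U phi s -> wo \subset Po ->
     mtbdd_eval (belief_delta rep Po U s) wo = fp_obs rep Po s wo).
Proof.
split; first exact: belief_states_finite.
split; last by move=> s wo _; apply: belief_delta_eval.
split=> //; first exact: belief_states_words.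
by move=> s wo _ woPo; rewrite /= belief_delta_eval.
Qed.
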